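(* For every homogeneous voting rule there is an algorithm solving the $(\epsilon,\delta)$-winner determination problem with sample complexity $O\!\left(\frac{(m!)^2\log\frac{m!}{\delta}}{\epsilon^2}\right)$.
   Context: An election consists of $n$ voters and a set $\mathcal{C}$ of $m$ candidates; each vote is a complete linear order over $\mathcal{C}$. A voting rule outputs a single winner (ties broken by an arbitrary fixed rule). A voting rule is homogeneous if it selects the winner solely based on the fraction of votes equal to each linear order over $\mathcal{C}$. The margin of victory (MOV) is the smallest number of votes that must be changed (others kept unchanged) to change the winner. The $(\epsilon,\delta)$-winner determination problem: given a voting rule and $n$ votes with MOV at least $\epsilon n$, output the winner with probability at least $1-\delta$ over the algorithm's internal randomness; the algorithm may query full votes of arbitrary voters, and the sample complexity is the number of queried votes. *)

(* Defs.v *)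
From HB Require Import structures.
From mathcomp Require Import all_boot all_order all_algebra.
From mathcomp Require Import all_classical all_reals all_analysis.

Set Implicit Arguments.
Unset Strict Implicit.
Unset Printing Implicit Defensive.

Import Order.TTheory GRing.Theory Num.Theory.
Local Open Scope ring_scope.

(* [p (x, y)] reads "x is ranked at least as high as y"; [total] includes
   reflexivity. *)
Definition linear_order (C : finType) (p : {ffun C * C -> bool}) : Prop :=
  let e : rel C := fun x y => p (x, y) in
  [/\ total e, transitive e & antisymmetric e].

Definition vote (C : finType) : finType :=
  {p : {ffun C * C -> bool} | `[< linear_order p >]}.

Definition profile (C : finType) (n : nat) : finType :=
  {ffun 'I_n -> vote C}.

(* The winner is a single candidate: the tie-breaking is part of the rule. *)
Definition voting_rule (C : finType) : Type :=
  forall n : nat, profile C n -> C.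

Definition vote_fraction (C : finType) (n : nat) (P : profile C n)
    (v : vote C) : rat :=
  #|[set i | P i == v]|%:R / n%:R.

(* The numbers of voters of the two elections may differ. *)
Definition homogeneous (C : finType) (r : voting_rule C) : Prop :=
  forall (n n' : nat) (P : profile C n) (P' : profile C n'),
    (0 < n)%N -> (0 < n')%N ->
    (forall v, vote_fraction P v = vote_fraction P' v) ->
    r n P = r n' P'.

Definition changed_votes (C : finType) (n : nat) (P Q : profile C n) : nat :=
  #|[set i | P i != Q i]|.

(* This is +oo when no change of the votes can change the winner. *)
Definition margin_of_victory (R : realType) (C : finType) (r : voting_rule C)
    (n : nat) (P : profile C n) : \bar R :=
  \big[Order.min/+oo%E]_(Q : profile C n | r n Q != r n P)
    ((changed_votes P Q)%:R)%:E.

(* Adaptive randomized query algorithms on profiles of n votes: an algorithm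
   stops with an output, or asks for the full vote of one voter and continues
   according to the answer, or draws an element of {0, ..., k} uniformly at
   random (independently of all previous draws) and continues according to
   it. *)
Inductive algorithm (C : finType) (n : nat) : Type :=
| Output of C
| Query of 'I_n & (vote C -> algorithm C n)
| Draw (k : nat) of ('I_k.+1 -> algorithm C n).

Fixpoint prob_output (R : realType) (C : finType) (n : nat)
    (a : algorithm C n) (P : profile C n) (c : C) : R :=
  match a with
  | Output c' => (c' == c)%:R
  | Query i f => prob_output R (f (P i)) P c
  | Draw k f => (\sum_(j < k.+1) prob_output R (f j) P c) / k.+1%:R
  end.

(* Worst case over the answers to the queries and the random draws; querying
   the same voter twice counts twice. *)
Fixpoint sample_complexity (C : finType) (n : nat) (a : algorithm C n) : nat :=
  match a with
  | Output _ => 0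
  | Query _ f => (\max_(v : vote C) sample_complexity (f v)).+1
  | Draw k f => \max_(j < k.+1) sample_complexity (f j)
  end%N.

(* [A n] is the algorithm run on n votes. *)
Definition solves_winner_determination (R : realType) (C : finType)
    (r : voting_rule C) (eps delta : R) (A : forall n, algorithm C n) : Prop :=
  forall (n : nat) (P : profile C n),
    ((eps * n%:R)%:E <= margin_of_victory R r P)%E ->
    1 - delta <= prob_output R (A n) P (r n P).

(* Main.v *)
(** Sample O(M^2 log(M/delta) / eps^2) votes uniformly with replacement, where
    M = m! bounds the number of linear orders. By a Chernoff bound and a union
    bound over the orders, all empirical frequencies are within eps/(4M) of the
    true ones with probability at least 1 - delta. Any profile of n votes with
    frequencies that close to the empirical ones can then be permuted, without
    changing its winner, so as to differ from the true profile in at most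
    eps n / 2 votes, hence it has the true winner. *)

Require Import Defs.
From HB Require Import structures.
From mathcomp Require Import all_boot all_order all_algebra.
From mathcomp Require Import all_fingroup.
From mathcomp Require Import all_classical all_reals all_analysis.
From mathcomp Require Import ring lra.
Set Implicit Arguments.
Unset Strict Implicit.
Unset Printing Implicit Defensive.

Import Order.TTheory GRing.Theory Num.Theory.
Local Open Scope ring_scope.

(** * Counting linear orders *)

(** An order is determined by the positions of the candidates in the list sorted by it, which is a
    permutation of [enum C]. *)
Lemma card_vote (C : finType) : (#|vote C| <= (#|C|)`!)%N.
Proof.
pose e (p : vote C) : rel C := fun x y => val p (x, y).
have eP (p : vote C) : [/\ total (e p), transitive (e p) & antisymmetric (e p)].
  exact: (asboolW (valP p)).
pose f (p : vote C) := sort (e p) (enum C).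
have f_index p x y : e p x y = (index x (f p) <= index y (f p))%N.
  have [e_tot e_tr e_asym] := eP p.
  have fs : sorted (e p) (f p) by exact: sort_sorted.
  have e_refl : reflexive (e p) by move=> z; have := e_tot z z; rewrite orbb.
  have in_f z : z \in f p by rewrite mem_sort mem_enum.
  have index_e a b : (index a (f p) <= index b (f p))%N -> e p a b.
    by apply: (sorted_leq_index e_tr e_refl fs).
  apply/idP/idP; last exact: index_e.
  move=> xy; rewrite leqNgt; apply/negP => lt_yx.
  have yx := index_e _ _ (ltnW lt_yx).
  have exy : x = y by apply: e_asym; rewrite xy yx.
  by rewrite exy ltnn in lt_yx.
have f_inj : injective f.
  move=> p q fpq; apply: val_inj; apply/ffunP => -[x y].
  by have := f_index p x y; have := f_index q x y; rewrite fpq /e => -> ->.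
have uniq_f : uniq [seq f p | p <- enum (vote C)].
  by rewrite map_inj_uniq // enum_uniq.
have := uniq_leq_size (s2 := permutations (enum C)) uniq_f.
rewrite size_map -cardE size_permutations ?enum_uniq // -cardE; apply.
by move=> _ /mapP[p _ ->]; rewrite mem_permutations perm_sort.
Qed.

(** * Permuting voters to bring two profiles together *)

Definition vote_count (C : finType) (n : nat) (P : profile C n) (v : vote C)
  : nat := #|[set i | P i == v]|.

Definition permute (C : finType) (n : nat) (s : {perm 'I_n}) (P : profile C n)
  : profile C n := [ffun i => P (s i)].

Lemma vote_count_permute (C : finType) (n : nat) (s : {perm 'I_n})
  (P : profile C n) v : vote_count (permute s P) v = vote_count P v.
Proof.
rewrite /vote_count -[RHS](card_preimset _ (@perm_inj _ s)).
by apply: eq_card => i; rewrite !inE ffunE.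
Qed.

Lemma changed_votes_sum (C : finType) (n : nat) (P Q : profile C n) :
  changed_votes P Q = (\sum_v #|[set i | (P i == v) && (Q i != v)]|)%N.
Proof.
rewrite /changed_votes -sum1_card (partition_big P predT) //=.
apply: eq_bigr => v _; rewrite -sum1_card; apply: eq_bigl => i.
by rewrite !inE; case: (P i =P v) => [->|_]; rewrite ?andbF ?andbT // eq_sym.
Qed.

(* In a permutation minimising the number of changes, no vote [v] is both
   missing at a voter of [P] and superfluous at another one: transposing these
   two voters would save a change. *)
Lemma permute_changed_votes (C : finType) (n : nat) (P Q : profile C n) :
  exists s, (changed_votes P (permute s Q) <=
             \sum_v (vote_count P v - vote_count Q v))%N.
Proof.
pose F s := changed_votes P (permute s Q).
have [s _ s_min] := arg_minnP (P := predT) F (i0 := 1%g) isT.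
exists s; rewrite changed_votes_sum; apply: leq_sum => v _.
rewrite -(vote_count_permute s Q); set Q' := permute s Q.
have [->|[i]] := set_0Vmem [set i | (P i == v) && (Q' i != v)].
  by rewrite cards0.
rewrite inE => /andP[/eqP Pi Q'i].
have sub : [set j | Q' j == v] \subset [set j | P j == v].
  apply/fintype.subsetP => j; rewrite !inE => /eqP Q'j.
  apply: contraT => Pj.
  have /= := s_min (tperm i j * s)%g isT.
  suff /fintype.proper_card : [set k | P k != permute (tperm i j * s)%g Q k]
      \proper [set k | P k != Q' k] by rewrite /F /changed_votes ltnNge => /negbTE ->.
  apply/properP; split.
    apply/fintype.subsetP => k; rewrite !inE !ffunE permM.
    case: tpermP => [->|->|_ _] //.
      by rewrite Pi; move: Q'j; rewrite ffunE => ->; rewrite eqxx.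
    by move: Q'j; rewrite ffunE => -> _.
  exists i; rewrite !inE; first by rewrite Pi eq_sym.
  by rewrite ffunE permM tpermL Pi; move: Q'j; rewrite ffunE => ->; rewrite eqxx.
have <- : #|[set j | P j == v] :\: [set j | Q' j == v]| =
    (vote_count P v - vote_count Q' v)%N by rewrite cardsD (finset.setIidPr sub).
by apply: subset_leq_card; apply/fintype.subsetP => k; rewrite !inE andbC.
Qed.

(** * Stability of the winner *)

Lemma winner_stable (R : realType) (C : finType) (r : voting_rule C) (n : nat)
    (P Q : profile C n) (x : R) :
  (x%:E <= margin_of_victory R r P)%E -> (changed_votes P Q)%:R < x ->
  r n Q = r n P.
Proof.
move=> le_mov lt_x; apply/eqP; apply: contraLR lt_x => neq.
rewrite -leNgt -lee_fin (le_trans le_mov) //.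
exact: (bigmin_le_cond _ (fun Q => ((changed_votes P Q)%:R)%:E) neq).
Qed.

Lemma homogeneous_permute (C : finType) (r : voting_rule C) (n : nat)
    (s : {perm 'I_n}) (P : profile C n) :
  homogeneous r -> r n (permute s P) = r n P.
Proof.
case: n s P => [|n] s P hom.
  (* Homogeneity concerns nonempty elections only; the empty profile is unique. *)
  by congr r; apply/ffunP => -[].
apply: hom => // v.
by have := vote_count_permute s P v; rewrite /vote_fraction /vote_count => ->.
Qed.

(** After a suitable permutation, only the orders more frequent in [P] than in [Q] account for
    changes, so a one-sided bound suffices. *)
Lemma winner_close (R : realType) (C : finType) (r : voting_rule C) (n : nat)
    (P Q : profile C n) (x d : R) :
  homogeneous r -> (x%:E <= margin_of_victory R r P)%E ->
  (forall v, (vote_count P v)%:R - (vote_count Q v)%:R <= d) -> 0 <= d ->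
  #|vote C|%:R * d < x ->
  r n Q = r n P.
Proof.
move=> hom le_mov le_d d0 lt_x.
have [s le_s] := permute_changed_votes P Q.
rewrite -(homogeneous_permute s Q hom).
apply: winner_stable le_mov _; apply: le_lt_trans lt_x.
apply: (@le_trans _ _ (\sum_v (vote_count P v - vote_count Q v)%N)%:R).
  by rewrite ler_nat.
rewrite natr_sum mulr_natl -sumr_const; apply: ler_sum => v _.
have [le_PQ|lt_QP] := leqP (vote_count P v) (vote_count Q v).
  by rewrite (eqP (_ : vote_count P v - vote_count Q v == 0)%N) // subn_eq0.
by rewrite natrB // ltnW.
Qed.

(** * Sampling with replacement *)

Fixpoint sample_then (C : finType) (n : nat) (dec : seq (vote C) -> C)
    (l : nat) (s : seq (vote C)) : algorithm C n.+1 :=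
  if l is l'.+1 then
    Draw (fun j => Query j (fun v => sample_then n dec l' (v :: s)))
  else Output n.+1 (dec s).

Lemma sample_complexity_sample_then (C : finType) (n : nat)
    (dec : seq (vote C) -> C) l s :
  (sample_complexity (sample_then n dec l s) <= l)%N.
Proof.
elim: l s => //= l IHl s; apply/bigmax_leqP => j _; rewrite ltnS.
by apply/bigmax_leqP => v _; exact: IHl.
Qed.

Section Sampling.
Variables (R : realType) (C : finType) (n : nat) (P : profile C n.+1).

(** Expectation of [g] over [s] extended by [l] independent uniform votes of [P]; on indicators it
    is a probability. *)
Fixpoint esample (g : seq (vote C) -> R) (l : nat) (s : seq (vote C)) : R :=
  if l is l'.+1 then (\sum_(j < n.+1) esample g l' (P j :: s)) / n.+1%:R
  else g s.

Lemma prob_sample_then dec l s c :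
  prob_output R (sample_then n dec l s) P c =
  esample (fun s => (dec s == c)%:R) l s.
Proof.
elim: l s => //= l IHl s; congr (_ / _).
by apply: eq_bigr => j _; exact: IHl.
Qed.

Lemma le_esample g h l s :
  (forall s, g s <= h s) -> esample g l s <= esample h l s.
Proof.
move=> gh; elim: l s => //= l IHl s.
by rewrite ler_pM2r ?invr_gt0 ?ltr0n // ler_sum.
Qed.

Lemma esample_cst a l s : esample (fun=> a) l s = a.
Proof.
elim: l s => //= l IHl s; under eq_bigr do rewrite IHl.
by rewrite sumr_const card_ord -(mulr_natr a) mulfK // pnatr_eq0.
Qed.

Lemma esampleD g h l s :
  esample (fun s => g s + h s) l s = esample g l s + esample h l s.
Proof.
elim: l s => //= l IHl s; under eq_bigr do rewrite IHl.
by rewrite big_split mulrDl.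
Qed.

Lemma esample_sum (I : finType) (g : I -> seq (vote C) -> R) l s :
  esample (fun s => \sum_i g i s) l s = \sum_i esample (g i) l s.
Proof.
elim: l s => //= l IHl s; under eq_bigr do rewrite IHl.
by rewrite exchange_big /= mulr_suml.
Qed.

(** Supermartingale argument: each draw multiplies the mean by at most [q]. *)
Lemma esample_geometric g q l s :
  (forall s, (\sum_(j < n.+1) g (P j :: s)) / n.+1%:R <= q * g s) -> 0 <= q ->
  esample g l s <= q ^+ l * g s.
Proof.
move=> gq q0; elim: l s => [s|l IHl s] /=; first by rewrite mul1r.
apply: (@le_trans _ _ (q ^+ l * ((\sum_(j < n.+1) g (P j :: s)) / n.+1%:R))).
  by rewrite mulrA ler_pM2r ?invr_gt0 ?ltr0n // mulr_sumr ler_sum.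
by rewrite exprSr -mulrA ler_wpM2l // exprn_ge0.
Qed.

End Sampling.

(** * Exponential moments *)

(** From [1 - x <= expR (- x)] follows [expR x <= 1 / (1 - x)], and the quadratic times [1 - x] is
    at least 1. *)
Lemma expR_le_quadratic (R : realType) (x : R) :
  x <= 1 / 2 -> expR x <= 1 + x + 2 * x ^+ 2.
Proof.
move=> x2; have x1 : 0 < 1 - x by lra.
have := expR_ge1Dx (- x); rewrite expRN => inv_ge.
have exp_le : expR x * (1 - x) <= 1.
  by rewrite mulrC -ler_pdivlMr ?expR_gt0 // div1r.
rewrite -(ler_pM2r x1); apply: le_trans exp_le _.
have -> : (1 + x + 2 * x ^+ 2) * (1 - x) = 1 + x ^+ 2 * (1 - 2 * x) by ring.
by rewrite lerDl mulr_ge0 ?sqr_ge0 //; lra.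
Qed.

(** A weak form of Hoeffding's lemma: the linear terms of the quadratic bound cancel in the mean. *)
Lemma mean_expR_le (R : realType) (n : nat) (x : 'I_n.+1 -> R) (a : R) :
  \sum_j x j = 0 -> (forall j, `|x j| <= a) -> a <= 1 / 2 ->
  (\sum_j expR (x j)) / n.+1%:R <= expR (2 * a ^+ 2).
Proof.
move=> x0 xa a2; rewrite ler_pdivrMr ?ltr0n //.
apply: (@le_trans _ _ (\sum_j (1 + x j + 2 * a ^+ 2))).
  apply: ler_sum => j _; have := xa j; rewrite ler_norml => /andP[l1 l2].
  apply: le_trans (expR_le_quadratic _) _; first lra.
  rewrite lerD2l ler_pM2l // -(real_normK (num_real (x j))).
  by rewrite lerXn2r ?nnegrE // (le_trans _ (xa j)).
rewrite !big_split /= x0 addr0 !sumr_const !card_ord -mulrnDl.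
by rewrite -[leLHS]mulr_natr ler_pM2r ?ltr0n // expR_ge1Dx.
Qed.

(** * Chernoff and union bounds *)

Section Deviation.
Variables (R : realType) (C : finType) (n : nat) (P : profile C n.+1).

Definition fraction (Q : profile C n.+1) v : R := (vote_count Q v)%:R / n.+1%:R.

(** Chernoff weight, used with [lam] equal to plus or minus [t / 4]: it is at least 1 once the count
    deviates by [t * size s] in the direction of [lam]. *)
Definition tilt (v : vote C) (t lam : R) (s : seq (vote C)) : R :=
  expR (lam * ((count_mem v s)%:R - (size s)%:R * fraction P v)
        - t ^+ 2 / 4 * (size s)%:R).

Lemma fraction_ge0 Q v : 0 <= fraction Q v.
Proof. by rewrite divr_ge0. Qed.

Lemma fraction_le1 Q v : fraction Q v <= 1.
Proof.
rewrite ler_pdivrMr ?ltr0n // mul1r ler_nat.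
by have := max_card [set i | Q i == v]; rewrite card_ord.
Qed.

(** With [u] the absolute value of [lam], one draw multiplies the mean weight by at most
    [expR (2 * u ^+ 2 - t * u)]; [u = t / 4] minimises this exponent. *)
Lemma esample_tilt v t lam l : 0 <= t <= 1 -> `|lam| = t / 4 ->
  esample P (tilt v t lam) l [::] <= expR (- (t ^+ 2 / 8)) ^+ l.
Proof.
move=> /andP[t0 t1] lamE.
have lam2 : lam ^+ 2 = (t / 4) ^+ 2 by rewrite -lamE real_normK ?num_real.
have -> : expR (- (t ^+ 2 / 8)) ^+ l =
    expR (- (t ^+ 2 / 8)) ^+ l * tilt v t lam [::].
  by rewrite /tilt /= !mul0r !mulr0 !subr0 mulr0 expR0 mulr1.
apply: esample_geometric; last exact: expR_ge0.
move=> s; pose x (j : 'I_n.+1) := lam * ((P j == v)%:R - fraction P v).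
have tiltE j : tilt v t lam (P j :: s) =
    expR (x j) * (expR (- (t ^+ 2 / 4)) * tilt v t lam s).
  rewrite /tilt -!expRD /x /= natrD; congr expR.
  rewrite -[(size s).+1]addn1 natrD; ring.
under eq_bigr do rewrite tiltE.
rewrite -mulr_suml mulrAC mulrA. rewrite ler_pM2r ?expR_gt0 //.
apply: (@le_trans _ _ (expR (2 * (t / 4) ^+ 2) * expR (- (t ^+ 2 / 4)))).
  rewrite ler_pM2r ?expR_gt0 //; apply: mean_expR_le; last lra.
    rewrite -mulr_sumr sumrB sumr_const card_ord -(mulr_natr (fraction P v)).
    rewrite divfK ?pnatr_eq0 // /vote_count -sum1_card natr_sum [X in _ - X]big_mkcond /=.
    rewrite -sumrB big1 ?mulr0 // => j _; rewrite inE.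
    by case: (P j == v); rewrite subrr.
  move=> j; rewrite normrM lamE ler_piMr ?divr_ge0 //.
  have := fraction_ge0 P v; have := fraction_le1 P v.
  by rewrite ler_norml; case: (P j == v) => /= f1 f0; apply/andP; split; lra.
by rewrite -expRD ler_expR; lra.
Qed.

Definition close (t : R) (s : seq (vote C)) (Q : profile C n.+1) :=
  [forall v, `|(count_mem v s)%:R / (size s)%:R - fraction Q v| <= t].

(** Pointwise Markov inequality: if [v] deviates by more than [t], the weight of matching sign is at
    least 1, by [1 + y <= expR y]. The sum over [v] is the union bound. *)
Lemma far_tilt t s : 0 <= t ->
  (~~ close t s P)%:R <=
  \sum_v (tilt v t (t / 4) s + tilt v t (- (t / 4)) s).
Proof.
move=> t0; have [_|] := boolP (close t s P).
  by rewrite sumr_ge0 // => v _; rewrite addr_ge0 ?expR_ge0.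
rewrite negb_forall => /existsP[v]; rewrite -ltNge => lt_t.
rewrite (bigD1 v) //=; apply: ler_wpDr.
  by rewrite sumr_ge0 // => w _; rewrite addr_ge0 ?expR_ge0.
rewrite /tilt; case: s lt_t => [|w s] lt_t.
  (* The empty sample has frequencies [0 / 0 = 0] and may be far, but both weights are then 1. *)
  by rewrite /= !mul0r !mulr0 !subr0 !mulr0 expR0; lra.
set k := (count_mem v (w :: s))%:R in lt_t *.
set N : R := (size (w :: s))%:R in lt_t *.
have N0 : 0 < N by rewrite ltr0n.
have : t * N < `|k - N * fraction P v|.
  have -> : k - N * fraction P v = (k / N - fraction P v) * N.
    by rewrite mulrBl divfK ?gt_eqF // [N * _]mulrC.
  by rewrite normrM (gtr0_norm N0) ltr_pM2r.
set D := k - _ => lt_D.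
have tD : t * (t * N) <= t * `|D| by rewrite ler_wpM2l // ltW.
have [D0|D0] := leP 0 D.
  rewrite ger0_norm // in tD.
  have := expR_ge1Dx (t / 4 * D - t ^+ 2 / 4 * N).
  have := expR_ge0 (- (t / 4) * D - t ^+ 2 / 4 * N).
  set e1 := expR _; set e2 := expR _; nra.
rewrite ltr0_norm // in tD.
have := expR_ge1Dx (- (t / 4) * D - t ^+ 2 / 4 * N).
have := expR_ge0 (t / 4 * D - t ^+ 2 / 4 * N).
set e1 := expR _; set e2 := expR _; nra.
Qed.

Lemma esample_far t l : 0 <= t <= 1 ->
  esample P (fun s => (~~ close t s P)%:R) l [::] <=
  2 * #|vote C|%:R * expR (- (t ^+ 2 / 8)) ^+ l.
Proof.
move=> t01; have /andP[t0 t1] := t01.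
apply: le_trans (le_esample _ _ _ (fun s => far_tilt s t0)) _.
rewrite esample_sum mulrAC mulr_natr -sumr_const; apply: ler_sum => v _.
rewrite esampleD mulr2n mulrDl mul1r lerD // esample_tilt // ?normrN ger0_norm //.
all: by rewrite divr_ge0.
Qed.

End Deviation.

(** * Decoding the sample *)

Lemma close_fraction (R : realType) (C : finType) (n : nat) (t : R) s
    (P Q : profile C n.+1) v :
  close t s P -> close t s Q ->
  (vote_count P v)%:R - (vote_count Q v)%:R <= 2 * t * n.+1%:R.
Proof.
move=> /forallP/(_ v) clP /forallP/(_ v) clQ.
rewrite -ler_pdivrMr ?ltr0n // mulrBl -/(fraction R P v) -/(fraction R Q v).
move: clP clQ; rewrite !ler_norml => /andP[p1 p2] /andP[q1 q2]; lra.
Qed.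

(* The decoded profile has exactly [n.+1] votes, since homogeneity does not
   relate the margin of victory for [n.+1] voters to the winner for another
   number of voters. *)
Definition decode (R : realType) (C : finType) (r : voting_rule C) (n : nat)
    (c0 : C) (t : R) (s : seq (vote C)) : C :=
  if [pick Q : profile C n.+1 | close t s Q] is Some Q then r n.+1 Q else c0.

Lemma decode_winner (R : realType) (C : finType) (r : voting_rule C) (n : nat)
    (c0 : C) (t x : R) s (P : profile C n.+1) :
  homogeneous r -> (x%:E <= margin_of_victory R r P)%E -> 0 <= t ->
  #|vote C|%:R * (2 * t * n.+1%:R) < x -> close t s P ->
  decode r n c0 t s = r n.+1 P.
Proof.
move=> hom le_mov t0 lt_x clP; rewrite /decode.
(* [P] itself is close to the sample, so the search succeeds and [c0] is not returned. *)
case: pickP => [Q clQ|/(_ P)]; last by rewrite clP.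
apply: winner_close hom le_mov _ _ lt_x; last by rewrite !mulr_ge0.
by move=> v; exact: close_fraction clP clQ.
Qed.

(** The indicators of a correct output and of a far sample add up to at least 1 on every sample;
    expectations are then taken. *)
Lemma prob_decode (R : realType) (C : finType) (r : voting_rule C) (n : nat)
    (c0 : C) (t x : R) l (P : profile C n.+1) :
  homogeneous r -> (x%:E <= margin_of_victory R r P)%E -> 0 <= t <= 1 ->
  #|vote C|%:R * (2 * t * n.+1%:R) < x ->
  1 - 2 * #|vote C|%:R * expR (- (t ^+ 2 / 8)) ^+ l <=
  prob_output R (sample_then n (decode r n c0 t) l [::]) P (r n.+1 P).
Proof.
move=> hom le_mov t01 lt_x; have /andP[t0 _] := t01.
rewrite prob_sample_then lerBlDr.
apply: le_trans (lerD (lexx _) (esample_far P l t01)).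
rewrite -esampleD -[leLHS](esample_cst P 1 l [::]).
apply: le_esample => s; have [clP|_] /= := boolP (close t s P).
  by rewrite (decode_winner c0 hom le_mov t0 lt_x clP) eqxx addr0.
by rewrite lerDr.
Qed.

(** * Choice of parameters and query complexity *)

Lemma ln2_ge (R : realType) : 1 / 2 <= ln 2 :> R.
Proof.
have := @le_ln1Dx R (- (1 / 2)); rewrite (_ : 1 + _ = 2^-1); last by lra.
by rewrite lnV ?posrE // => /(_ _); lra.
Qed.

(** For [n > 0] the margin exceeds [n], while two profiles differ in at most [n] votes. *)
Lemma constant_winner (R : realType) (C : finType) (r : voting_rule C)
    (n : nat) (eps : R) (P Q : profile C n) :
  1 < eps -> ((eps * n%:R)%:E <= margin_of_victory R r P)%E -> r n Q = r n P.
Proof.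
case: n P Q => [|n] P Q eps1 le_mov.
  by congr r; apply/ffunP => -[].
apply: winner_stable le_mov _.
apply: (@le_lt_trans _ _ n.+1%:R); last by rewrite ltr_pMl ?ltr0n.
by rewrite ler_nat (leq_trans (max_card _)) // card_ord.
Qed.

(** Two profiles close to one sample differ by at most twice this on each order, hence by at most
    [eps / 2] in total over at most m! orders. *)
Definition tolerance (R : realType) (C : finType) (eps : R) : R :=
  eps / (4 * (#|C|)`!%:R).

(** The failure bound [2 * m! * expR (- (t ^+ 2 / 8)) ^+ l <= delta], with [t] the tolerance, solved
    for [l] and rounded up. *)
Definition sample_size (R : realType) (C : finType) (eps delta : R) : nat :=
  (Num.truncn (8 * ln (2 * (#|C|)`!%:R / delta) / tolerance C eps ^+ 2)).+1.

(* One query would already exceed the bound when [1 < eps], and, as [delta]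
   tends to [1], when there is a single candidate. *)
Definition winner_algorithm (R : realType) (C : finType) (r : voting_rule C)
    (c0 : C) (eps delta : R) (n : nat) : algorithm C n :=
  if n is n'.+1 then
    if (eps <= 1) && (1 < #|C|)%N then
      sample_then n' (decode r n' c0 (tolerance C eps)) (sample_size C eps delta)
        [::]
    else Output n'.+1 (if [pick Q : profile C n'.+1] is Some Q then r _ Q else c0)
  else Output 0 c0.

Section Complexity.
Variables (R : realType) (C : finType) (eps delta : R).
Hypotheses (eps01 : 0 < eps <= 1) (delta01 : 0 < delta < 1).

Let M : R := (#|C|)`!%:R.

Lemma fact_card_gt0 : 0 < M.
Proof. by rewrite ltr0n fact_gt0. Qed.

Lemma tolerance01 : 0 < tolerance C eps <= 1.
Proof.
have /andP[e0 e1] := eps01; have M0 := fact_card_gt0.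
have M1 : 1 <= M by rewrite ler1n fact_gt0.
rewrite divr_gt0 ?mulr_gt0 //= ler_pdivrMr ?mulr_gt0 // -/M; lra.
Qed.

Lemma sample_size_failure :
  2 * #|vote C|%:R * expR (- (tolerance C eps ^+ 2 / 8)) ^+ sample_size C eps delta
  <= delta.
Proof.
have /andP[d0 d1] := delta01; have /andP[t0 t1] := tolerance01.
have M0 := fact_card_gt0.
apply: (@le_trans _ _ (2 * M * expR (- ln (2 * M / delta)))).
  apply: ler_pM; rewrite ?mulr_ge0 ?exprn_ge0 ?expR_ge0 //.
    by rewrite ler_pM2l // ler_nat card_vote.
  rewrite -expRM_natl ler_expR mulrN lerN2 mulrA ler_pdivlMr //.
  rewrite [ln _ * 8]mulrC -ler_pdivrMr ?exprn_gt0 //.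
  exact/ltW/truncnS_gt.
rewrite expRN lnK ?posrE ?divr_gt0 ?mulr_gt0 // invf_div mulrC divfK //.
by rewrite mulf_neq0 // gt_eqF.
Qed.

(** With two candidates [M / delta] is at least 2, so its logarithm dominates [ln 2] and stays away
    from 0, which absorbs the rounding. *)
Lemma sample_size_le : (1 < #|C|)%N ->
  (sample_size C eps delta)%:R <= 512 * ((M ^+ 2 * ln (M / delta)) / eps ^+ 2).
Proof.
move=> C2; have /andP[e0 e1] := eps01; have /andP[d0 d1] := delta01.
have M2 : 2 <= M.
  by rewrite ler_nat (leq_trans _ (fact_geq _)).
have Md : 2 <= M / delta by rewrite ler_pdivlMr //; nra.
have lnMd : ln 2 <= ln (M / delta).
  by rewrite ler_ln ?posrE //; lra.
have ln2 := ln2_ge R.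
have ln2Md : ln (2 * M / delta) = ln 2 + ln (M / delta).
  by rewrite -mulrA lnM ?posrE //; lra.
set a : R := M ^+ 2 / eps ^+ 2.
have a1 : 4 <= a.
  by rewrite ler_pdivlMr ?exprn_gt0 //; nra.
rewrite /sample_size; set x := (X in Num.truncn X).
have xE : x = 128 * a * (ln 2 + ln (M / delta)).
  rewrite /x ln2Md /a /tolerance -/M; field; rewrite -/M; lra.
have -> : M ^+ 2 * ln (M / delta) / eps ^+ 2 = a * ln (M / delta).
  by rewrite /a mulrAC.
have x0 : 0 <= x by rewrite xE; nra.
rewrite -natr1; have := truncn_le x; rewrite x0 => le_x.
apply: (@le_trans _ _ (x + 1)); first by rewrite lerD2r.
(* The [ln 2] term at most doubles 128, and the added 1 fits in the remaining slack. *)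
rewrite xE; nra.
Qed.

End Complexity.

Theorem theorem4 (R : realType) :
  exists K : R, forall (C : finType) (r : voting_rule C), homogeneous r ->
  exists A : R -> R -> forall n : nat, algorithm C n,
  forall eps delta : R, 0 < eps -> 0 < delta < 1 ->
    solves_winner_determination r eps delta (A eps delta) /\
    forall n : nat,
      (sample_complexity (A eps delta n))%:R <=
        K * (((#|C|)`!%:R ^+ 2 * ln ((#|C|)`!%:R / delta)) / eps ^+ 2).
Proof.
exists 512 => C r hom.
(* The winner of the empty election serves as default candidate and is the right output for 0
   voters. *)
pose P0 : profile C 0 := finfun (fun i : 'I_0 => match notF (ltn_ord i) with end).
exists (winner_algorithm r (r 0%N P0)) => eps delta e0 d01.
have /andP[d0 d1] := d01.
(* This settles the branches that make no query. *)
have bound_ge0 : 0 <= 512 * ((#|C|)`!%:R ^+ 2 * ln ((#|C|)`!%:R / delta)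
    / eps ^+ 2) :> R.
  rewrite mulr_ge0 // divr_ge0 ?sqr_ge0 // mulr_ge0 ?sqr_ge0 // ln_ge0 //.
  by rewrite ler_pdivlMr // mul1r (le_trans (ltW d1)) // ler1n fact_gt0.
split; last first.
  move=> [|n] //=; case: ifP => [/andP[e1 C2]|_] //.
  apply: le_trans (sample_size_le _ _ C2); rewrite ?e0 //.
  by rewrite ler_nat; exact: sample_complexity_sample_then.
move=> [|n] P le_mov.
- rewrite /= (_ : P0 = P) ?eqxx; last by apply/ffunP => -[].
  by rewrite gerBl ltW.
- rewrite /winner_algorithm; case: ifPn => [/andP[e1 C2]|].
    have e01 : 0 < eps <= 1 by rewrite e0.
    have /andP[t0 t1] := tolerance01 C e01.
    apply: le_trans (prob_decode _ _ hom le_mov _ _).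
    + by rewrite lerD2l lerN2 sample_size_failure.
    + by rewrite ltW.
    + rewrite mulrA ltr_pM2r ?ltr0n //.
      apply: (@le_lt_trans _ _ (eps / 2)); last by lra.
      apply: (@le_trans _ _ ((#|C|)`!%:R * (2 * tolerance C eps))).
        by rewrite ler_wpM2r ?mulr_ge0 ?ler_nat ?card_vote // ltW.
      rewrite /tolerance le_eqVlt; apply/orP; left; apply/eqP; field.
      by rewrite gt_eqF // ltr0n fact_gt0.
  (* Without queries any profile will do: either the margin exceeds the number of voters or there is
     a single candidate. *)
  rewrite negb_and -ltNge -leqNgt => triv.
  case: pickP => [Q _|/(_ P)] //=; rewrite (_ : r _ Q = r _ P) ?eqxx.
    by rewrite gerBl ltW.
  have [e1|C1] := orP triv; first exact: constant_winner e1 le_mov.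
  exact: (fintype_le1P C1).
Qed.
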